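(* If $g\colon\mathbb R\to\mathbb R$ is a continuous function satisfying $$g^3(x)=3g(x)-2x\quad\text{for every }x\in\mathbb R,$$ then there exists $c\in\mathbb R$ such that either $$g(x)=x+c\quad\text{for every }x\in\mathbb R,$$ or $$g(x)=-2x+c\quad\text{for every }x\in\mathbb R.$$
   Context: For a self-mapping $g\colon \mathbb R\to \mathbb R$, $g^n$ denotes the $n$-th iterate of $g$: $g^0=\mathrm{id}_{\mathbb R}$ and $g^k=g\circ g^{k-1}$ for all integers $k\ge 1$ (so $g^3=g\circ g\circ g$). *)

(* Defs.v *)
From Stdlib Require Export Reals.

(* Main.v *)
(** The characteristic polynomial of the recurrence is [(r - 1)^2 (r + 2)], so
    along an orbit [E x = g (g x) + g x - 2 x] is invariant while
    [F x = g (g x) - 2 g x + x] is multiplied by [-2], and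
    [3 (g x - x) = E x - F x].
    The equation makes [g] injective, hence strictly monotone, and unbounded on
    both sides, hence surjective.
    If [g] is increasing then [g x - x] keeps its sign along orbits, which gives
    [|F| <= |E|]; going forward this forces [F = 0], so that orbits are
    arithmetic progressions, and comparing two of them, forward and backward,
    shows that their steps agree.
    If [g] is decreasing then [g x - x] alternates in sign, which gives
    [|E| <= 2 |F|]; going backward this forces [E = 0], and backward orbits then
    converge to [(g x + 2 x) / 3], which must be the fixed point of [g]. *)

Require Import Defs.
From Stdlib Require Import Reals.
From Stdlib Require Import Lra.
Open Scope R_scope.

Lemma nonpos_of_INR_mult_bounded (a b : R) :
  (forall n : nat, INR n * a <= b) -> a <= 0.
Proof.
  intros H. destruct (Rle_or_lt a 0) as [Ha | Ha]; [exact Ha |].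
  destruct (INR_archimed a b Ha) as [n Hn]. specialize (H n). lra.
Qed.

Lemma INR_le_pow2 (n : nat) : INR n <= 2 ^ n.
Proof.
  assert (H := poly n 1 Rlt_0_1).
  replace (1 + 1) with 2 in H by ring. lra.
Qed.

Lemma eq0_of_pow2_Rabs_bounded (a b : R) :
  (forall n : nat, 2 ^ n * Rabs a <= b) -> a = 0.
Proof.
  intros H.
  assert (Ha : Rabs a <= 0).
  { apply (nonpos_of_INR_mult_bounded _ b). intros n.
    apply Rle_trans with (2 ^ n * Rabs a); [| apply H].
    apply Rmult_le_compat_r; [apply Rabs_pos | apply INR_le_pow2]. }
  revert Ha. unfold Rabs. destruct (Rcase_abs a); lra.
Qed.

Lemma continuity_root (f : R -> R) (a b : R) :
  continuity f -> f a * f b <= 0 -> exists z, f z = 0.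
Proof.
  intros Hf Hab. destruct (Rle_or_lt a b) as [Hle | Hlt].
  - destruct (IVT_cor f a b Hf Hle Hab) as [z [_ Hz]]. now exists z.
  - rewrite Rmult_comm in Hab.
    destruct (IVT_cor f b a Hf (Rlt_le _ _ Hlt) Hab) as [z [_ Hz]]. now exists z.
Qed.

Lemma continuity_affine (a b : R) : continuity (fun t => a + t * b).
Proof. intros t. reg. Qed.

Definition increasing_on_R (f : R -> R) := forall x y, x < y -> f x < f y.
Definition decreasing_on_R (f : R -> R) := forall x y, x < y -> f y < f x.

(* Two pairs [x < y] and [x' < y'] are joined by a segment of such pairs, along
   which [f y - f x] cannot vanish. *)
Lemma injective_same_sign (f : R -> R) (x y x' y' : R) :
  continuity f -> (forall u v, f u = f v -> u = v) ->
  x < y -> x' < y' -> 0 < (f y - f x) * (f y' - f x').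
Proof.
  intros Hf Hinj Hxy Hxy'.
  destruct (Rlt_or_le 0 ((f y - f x) * (f y' - f x'))) as [H | H]; [exact H |].
  exfalso.
  set (s := fun t => x + t * (x' - x)).
  set (e := fun t => (y - x) + t * ((y' - x') - (y - x))).
  set (k := fun t => f ((y - x + t * (y' - x' - (y - x))) + (x + t * (x' - x)))
                     - f (x + t * (x' - x))).
  assert (Hk : continuity k).
  { apply (continuity_minus (comp f (fun t => e t + s t)) (comp f s)).
    - apply continuity_comp; [| exact Hf].
      apply (continuity_plus e s); apply continuity_affine.
    - apply continuity_comp; [apply continuity_affine | exact Hf]. }
  assert (Hk01 : k 0 * k 1 <= 0).
  { unfold k.
    replace (y - x + 0 * (y' - x' - (y - x)) + (x + 0 * (x' - x))) with y by ring.
    replace (x + 0 * (x' - x)) with x by ring.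
    replace (y - x + 1 * (y' - x' - (y - x)) + (x + 1 * (x' - x))) with y' by ring.
    replace (x + 1 * (x' - x)) with x' by ring. exact H. }
  destruct (IVT_cor k 0 1 Hk Rle_0_1 Hk01) as [t [Ht Hkt]].
  apply Rminus_diag_uniq, Hinj in Hkt.
  (* [Hkt] says that the gap [(1 - t) * (y - x) + t * (y' - x')] is zero, yet its first term is
     positive for [t <= 1 / 2] and its second for [t > 1 / 2]. *)
  assert (0 <= (1 - t) * (y - x)) by (apply Rmult_le_pos; lra).
  assert (0 <= t * (y' - x')) by (apply Rmult_le_pos; lra).
  destruct (Rle_or_lt t (1 / 2)); nra.
Qed.

Lemma injective_monotone (f : R -> R) :
  continuity f -> (forall u v, f u = f v -> u = v) ->
  increasing_on_R f \/ decreasing_on_R f.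
Proof.
  intros Hf Hinj.
  assert (H : forall x y, x < y -> 0 < (f y - f x) * (f 1 - f 0)).
  { intros x y Hxy. apply injective_same_sign; auto using Rlt_0_1. }
  destruct (Rlt_or_le 0 (f 1 - f 0)) as [H01 | H01];
    [left | right]; intros x y Hxy; specialize (H x y Hxy); nra.
Qed.

Section Recurrence.

Variable g : R -> R.
Hypothesis g_rec : forall x, g (g (g x)) = 3 * g x - 2 * x.

(** The equation recovers [x] from [g x]: [2 * x = 3 * g x - g (g (g x))]. *)
Lemma rec_injective (u v : R) : g u = g v -> u = v.
Proof.
  intros H. assert (Hu := g_rec u). assert (Hv := g_rec v).
  rewrite H in Hu. lra.
Qed.

(** If [m <= g], then for increasing [g] the value [3 * g x - 2 * x] is too large as [x] tends to
    minus infinity, since [g (g (g x))] stays below [g (g (g 0))]. For decreasing [g] it drops below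
    [m] as [x] tends to plus infinity. *)
Lemma rec_not_bounded_below (m : R) :
  increasing_on_R g \/ decreasing_on_R g -> exists x, g x < m.
Proof.
  intros Hmono.
  destruct (Classical_Prop.classic (exists x, g x < m)) as [H | H]; [exact H |].
  exfalso.
  assert (Hm : forall x, m <= g x).
  { intros x. destruct (Rle_or_lt m (g x)) as [Hx | Hx]; [exact Hx |].
    exfalso. apply H. now exists x. }
  destruct Hmono as [Hg | Hg].
  - set (x := Rmin (-1) ((3 * m - g (g (g 0))) / 2)).
    assert (Hx0 : x <= -1) by apply Rmin_l.
    assert (Hx1 : x <= (3 * m - g (g (g 0))) / 2) by apply Rmin_r.
    assert (Hlt : g (g (g x)) < g (g (g 0))) by (apply Hg, Hg, Hg; lra).
    assert (Hx := g_rec x). specialize (Hm x). lra.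
  - set (x := Rmax 1 ((3 * g 0 - m) / 2)).
    assert (Hx0 : 1 <= x) by apply Rmax_l.
    assert (Hx1 : (3 * g 0 - m) / 2 <= x) by apply Rmax_r.
    assert (Hlt : g x < g 0) by (apply Hg; lra).
    assert (Hx := g_rec x). specialize (Hm (g (g x))). lra.
Qed.

Lemma step_invariant (x : R) :
  g (g (g x)) + g (g x) - 2 * g x = g (g x) + g x - 2 * x.
Proof. rewrite g_rec. ring. Qed.

Lemma defect_scale (x : R) :
  g (g (g x)) - 2 * g (g x) + g x = -2 * (g (g x) - 2 * g x + x).
Proof. rewrite g_rec. ring. Qed.

(** Induction on [n] for all [x] at once: the bound [2 ^ n * |F| <= |E|] at [g x] is the next bound
    at [x], as [F] doubles in size and [E] is unchanged. *)
Lemma increasing_defect_zero :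
  increasing_on_R g -> forall x, g (g x) - 2 * g x + x = 0.
Proof.
  intros Hg x.
  apply (eq0_of_pow2_Rabs_bounded _ (Rabs (g (g x) + g x - 2 * x))).
  intros n. revert x. induction n as [| n IH]; intros x.
  - rewrite pow_O, Rmult_1_l.
    assert (Hs : 0 <= (g x - x) * (g (g x) - g x)).
    { destruct (Rtotal_order x (g x)) as [H | [H | H]].
      - assert (H' := Hg _ _ H). nra.
      - rewrite <- H at 1. lra.
      - assert (H' := Hg _ _ H). nra. }
    (* With [u = g x - x] and [v = g (g x) - g x], [E = v + 2 u] and [F = v - u], so
       [E^2 - F^2 = 3 u^2 + 6 u v]. *)
    apply Rsqr_le_abs_0. unfold Rsqr.
    assert (Hsq := pow2_ge_0 (g x - x)). nra.
  - specialize (IH (g x)).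
    rewrite step_invariant, defect_scale, Rabs_mult in IH.
    rewrite (Rabs_left (-2)) in IH by lra. simpl. lra.
Qed.

Hypothesis g_surj : forall y, exists x, g x = y.

(** Orbits are arithmetic progressions and [g] preserves order, so the gap [y - x] changes by [n]
    times the difference of the steps and stays positive. Images bound that difference on one side,
    preimages on the other. *)
Lemma increasing_translation :
  increasing_on_R g -> forall x y, x < y -> g x - x = g y - y.
Proof.
  intros Hg.
  assert (Hd : forall x, g (g x) - g x = g x - x).
  { intros x. assert (H := increasing_defect_zero Hg x). lra. }
  assert (Hrefl : forall x y, g x < g y -> x < y).
  { intros x y Hxy. destruct (Rtotal_order x y) as [H | [H | H]]; [exact H | |].
    - subst. lra.
    - specialize (Hg _ _ H). lra. }
  intros x y Hxy. apply Rle_antisym.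
  - assert (H : (g x - x) - (g y - y) <= 0); [| lra].
    apply (nonpos_of_INR_mult_bounded _ (y - x)). intros n.
    revert x y Hxy. induction n as [| n IH]; intros x y Hxy.
    + simpl. lra.
    + specialize (IH _ _ (Hg _ _ Hxy)). rewrite !Hd in IH.
      rewrite S_INR. lra.
  - assert (H : (g y - y) - (g x - x) <= 0); [| lra].
    apply (nonpos_of_INR_mult_bounded _ (y - x)). intros n.
    revert x y Hxy. induction n as [| n IH]; intros x y Hxy.
    + simpl. lra.
    + destruct (g_surj x) as [x' <-]. destruct (g_surj y) as [y' <-].
      specialize (IH _ _ (Hrefl _ _ Hxy)). rewrite !Hd.
      rewrite S_INR. lra.
Qed.

Lemma decreasing_step_zero :
  decreasing_on_R g -> forall x, g (g x) + g x - 2 * x = 0.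
Proof.
  intros Hg x.
  apply (eq0_of_pow2_Rabs_bounded _ (2 * Rabs (g (g x) - 2 * g x + x))).
  intros n. revert x. induction n as [| n IH]; intros x.
  - rewrite pow_O, Rmult_1_l.
    assert (Hs : (g x - x) * (g (g x) - g x) <= 0).
    { destruct (Rtotal_order x (g x)) as [H | [H | H]].
      - assert (H' := Hg _ _ H). nra.
      - rewrite <- H at 1. lra.
      - assert (H' := Hg _ _ H). nra. }
    (* With [u = g x - x] and [v = g (g x) - g x], [(2 F)^2 - E^2 = 3 v^2 - 12 u v], where
       [u v <= 0]. *)
    replace 2 with (Rabs 2) at 2 by (apply Rabs_right; lra).
    rewrite <- Rabs_mult. apply Rsqr_le_abs_0. unfold Rsqr.
    assert (Hsq := pow2_ge_0 (g (g x) - g x)). nra.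
  - destruct (g_surj x) as [y <-]. specialize (IH y).
    rewrite step_invariant, defect_scale, Rabs_mult.
    rewrite (Rabs_left (-2)) by lra. simpl. lra.
Qed.

(** Put [q = (g x + 2 * x) / 3]. As [E = 0], [q] is constant along orbits and
    [g x - q = -2 * (x - q)]. Since [p] lies between [x] and [g x], [|p - q| <= 2 * |x - q|], and
    each passage to a preimage halves the right side. *)
Lemma decreasing_fixed_point (p : R) :
  decreasing_on_R g -> g p = p -> forall x, g x = - 2 * x + 3 * p.
Proof.
  intros Hg Hp x.
  assert (HE : forall z, g (g z) = 2 * z - g z).
  { intros z. assert (H := decreasing_step_zero Hg z). lra. }
  assert (H : p - (g x + 2 * x) / 3 = 0); [| lra].
  apply (eq0_of_pow2_Rabs_bounded _ (2 * Rabs (x - (g x + 2 * x) / 3))).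
  intros n. revert x. induction n as [| n IH]; intros x.
  - rewrite pow_O, Rmult_1_l.
    assert (Hs : (x - p) * (g x - p) <= 0).
    { destruct (Rtotal_order x p) as [H | [H | H]].
      - specialize (Hg _ _ H). nra.
      - subst x. lra.
      - specialize (Hg _ _ H). nra. }
    replace 2 with (Rabs 2) at 2 by (apply Rabs_right; lra).
    rewrite <- Rabs_mult. apply Rsqr_le_abs_0. unfold Rsqr.
    assert (Hsq := pow2_ge_0 (g x - p)). nra.
  - destruct (g_surj x) as [y <-]. specialize (IH y). rewrite HE.
    replace (2 * y - g y + 2 * g y) with (g y + 2 * y) by ring.
    replace (g y - (g y + 2 * y) / 3) with (-2 * (y - (g y + 2 * y) / 3)) by field.
    rewrite Rabs_mult, (Rabs_left (-2)) by lra. simpl. lra.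
Qed.

End Recurrence.

(** Stated outside the section so that [rec_not_bounded_below] applies to [g] and also to a
    conjugate, which gives unboundedness above. The intermediate value theorem does the rest. *)
Lemma rec_surjective (g : R -> R) :
  (forall x, g (g (g x)) = 3 * g x - 2 * x) -> continuity g ->
  increasing_on_R g \/ decreasing_on_R g -> forall y, exists x, g x = y.
Proof.
  intros Hrec Hcont Hmono y.
  destruct (rec_not_bounded_below g Hrec y Hmono) as [a Ha].
  (* The conjugate [x |-> - g (- x)] satisfies the same hypotheses. *)
  assert (Hup : exists x, - g (- x) < - y).
  { apply (rec_not_bounded_below (fun x => - g (- x))).
    - intros x. rewrite !Ropp_involutive, Hrec. ring.
    - destruct Hmono as [H | H]; [left | right]; intros u v Huv;
        apply Ropp_lt_contravar, H; lra. }
  destruct Hup as [b Hb].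
  destruct (continuity_root (fun x => g x - y) a (- b)) as [z Hz].
  - apply (continuity_minus g (fct_cte y) Hcont).
    apply continuity_const. now intros u v.
  - nra.
  - exists z. lra.
Qed.

Theorem theorem3p3 (g : R -> R) (hg : continuity g)
    (heq : forall x : R, Nat.iter 3%nat g x = 3 * g x - 2 * x) :
  exists c : R,
    (forall x : R, g x = x + c) \/ (forall x : R, g x = - 2 * x + c).
Proof.
  assert (Hrec : forall x, g (g (g x)) = 3 * g x - 2 * x) by exact heq.
  assert (Hmono := injective_monotone g hg (rec_injective g Hrec)).
  assert (Hsurj := rec_surjective g Hrec hg Hmono).
  destruct Hmono as [Hg | Hg].
  - exists (g 0). left. intros x.
    assert (H := increasing_translation g Hrec Hsurj Hg).
    destruct (Rtotal_order x 0) as [Hx | [Hx | Hx]].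
    + specialize (H _ _ Hx). lra.
    + subst. lra.
    + specialize (H _ _ Hx). lra.
  - destruct (continuity_root (fun x => g x - x) 0 (g 0)) as [p Hp].
    + apply (continuity_minus g id hg), derivable_continuous, derivable_id.
    (* [E = 0] at [0] gives [g (g 0) = - g 0], so the product of the two end values is
       [-2 * (g 0)^2]. *)
    + assert (H := decreasing_step_zero g Hrec Hsurj Hg 0). nra.
    + exists (3 * p). right.
      apply (decreasing_fixed_point g Hrec Hsurj p Hg). lra.
Qed.
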